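(* Let $n,m\in\mathbb{N}$, $A\in\mathbb{R}^{n\times n}$, $B\in\mathbb{R}^{n\times m}$, $x_0\in\mathbb{R}^n$, $T>0$, and let $\phi:\mathbb{R}^m\to\mathbb{R}$ satisfy all of the following: (A1) there exist functions $\phi_j:\mathbb{R}\to\mathbb{R}$, $j=1,\dots,m$, with $\phi(u)=\sum_{j=1}^m\phi_j(u_j)$ for all $u=[u_1,\dots,u_m]^\top\in\mathbb{R}^m$, and these functions satisfy (A2)--(A4); (A2) $\phi_j(a)=\phi_j(-a)$ for all $a\in[0,1]$ and all $j=1,\dots,m$; (A3) for all $j=1,\dots,m$: $\phi_j(0)=0$, $\phi_j(a)<\phi_j(1)|a|$ for all $a\in(-1,1)\setminus\{0\}$, and $\phi_j(1)<1$; (A4) $\phi_i(1)=\phi_j(1)$ for all $i,j=1,\dots,m$. Suppose that the set $\mathcal{U}(x_0,T)$ of feasible controls is not empty. Let $\mathcal{U}_1^\ast$ be the set of all optimal solutions to the problem of minimizing $\|u\|_{L^0}$ subject to $u\in\mathcal{U}(x_0,T)$, and let $\mathcal{U}_2^\ast$ be the set of all optimal solutions to the problem of minimizing $$J(u)=\|u\|_{L^1}-\int_0^T\phi(u(t))\,dt$$ subject to $u\in\mathcal{U}(x_0,T)$. Then $\mathcal{U}_1^\ast$ and $\mathcal{U}_2^\ast$ are not empty, and $\mathcal{U}_1^\ast=\mathcal{U}_2^\ast$.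
   Context: Consider the linear system $\dot x(t)=Ax(t)+Bu(t)$, $0\le t\le T$, with $x(0)=x_0$. The set of feasible controls, i.e. (Lebesgue measurable) controls steering $x_0$ to $0$ at time $T$ under the magnitude constraint $\|u\|_{L^\infty}\le1$, is $$\mathcal{U}(x_0,T)=\left\{u:[0,T]\to\mathbb{R}^m \text{ measurable}:\ \int_0^T e^{-At}Bu(t)\,dt=-x_0,\ \|u\|_{L^\infty}\le 1\right\}.$$ Norms, for $u=[u_1,\dots,u_m]^\top$ on $[0,T]$, with $\mu$ the Lebesgue measure on $\mathbb{R}$: $\|u\|_{L^0}=\sum_{j=1}^m\mu(\{t\in[0,T]:u_j(t)\ne0\})$, $\|u\|_{L^1}=\sum_{j=1}^m\int_0^T|u_j(t)|\,dt$, $\|u\|_{L^\infty}=\max_{1\le j\le m}\operatorname{ess\,sup}_{0\le t\le T}|u_j(t)|$. The cost $J$ is taken to be a real-valued function on $\mathcal{U}(x_0,T)$, i.e. $t\mapsto\phi(u(t))$ is integrable on $[0,T]$ for every $u\in\mathcal{U}(x_0,T)$. An optimal solution is a feasible $u$ attaining the minimum of the cost over $\mathcal{U}(x_0,T)$. *)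

(* Defs.v *)
From HB Require Import structures.
From mathcomp Require Export all_boot all_order all_algebra.
From mathcomp Require Export all_classical all_reals all_analysis ess_sup_inf.
Export Order.TTheory GRing.Theory Num.Theory.
Export numFieldNormedType.Exports.

#[export] Set Implicit Arguments.
#[export] Unset Strict Implicit.
#[export] Unset Printing Implicit Defensive.

#[global] Open Scope classical_set_scope.
#[global] Open Scope ring_scope.

(* The real line with the sigma-algebra of Lebesgue (not merely Borel)
   measurable sets, which carries [completed_lebesgue_measure]. *)
Notation lebesgueR R :=
  (caratheodory_type (R := R) (T := ocitv_type R) (wlength idfun)^*%mu).

Notation lebesgue R := (@completed_lebesgue_measure R).

Definition horizon {R : realType} (T : R) : set (lebesgueR R) :=
  [set t : R | 0 <= t <= T].

Definition expmx {R : realType} {n : nat} (A : 'M[R]_n) : 'M[R]_n :=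
  limn (series (fun k : nat => k`!%:R^-1 *: A ^+ k)).

(* A control on [0, T] is a function on the whole line of which only the values
   on [0, T] are ever used. *)
Definition control (R : realType) (m : nat) := lebesgueR R -> 'cV[R]_m.

Section norms.
Context {R : realType} {m : nat} (T : R).
Implicit Type u : control R m.
Local Open Scope ereal_scope.

Definition L0norm u : \bar R :=
  \sum_(j < m) lebesgue R (horizon T `&` [set t | u t j ord0 != 0%R]).

Definition L1norm u : \bar R :=
  \sum_(j < m) \int[lebesgue R]_(t in horizon T) `|u t j ord0|%:E.

(* |u_j| is extended by 0 outside [0, T]; being nonnegative, it keeps the same
   essential supremum. *)
Definition Linfnorm u : \bar R :=
  \big[maxe/0]_(j < m)
    ess_sup (lebesgue R) ((fun t => `|u t j ord0|%:E) \_ (horizon T)).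

Definition Jcost (phi : 'cV[R]_m -> R) u : \bar R :=
  L1norm u - \int[lebesgue R]_(t in horizon T) (phi (u t))%:E.

End norms.

(* The vector-valued integral is taken componentwise. *)
Definition feasible {R : realType} {n m : nat} (A : 'M[R]_n)
    (B : 'M[R]_(n, m)) (x0 : 'cV[R]_n) (T : R) : set (control R m) :=
  [set u : control R m | [/\ forall j, measurable_fun (horizon T) (fun t => u t j ord0),
     forall i, (\int[lebesgue R]_(t in horizon T)
       ((expmx (- (t : R) *: A) *m B *m u t) i ord0)%:E = (- x0 i ord0)%:E)%E
   & (Linfnorm T u <= 1)%E]].

Definition optimal {R : realType} {X : Type} (U : set X) (cost : X -> \bar R)
    : set X :=
  [set u | U u /\ forall v, U v -> (cost u <= cost v)%E].

(* Main.v *)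
Require Import Defs.
From mathcomp Require Import measurable_realfun lra.

(** Among the controls bounded by 1, the L1 norm is at most the L0 norm, with
equality exactly for the controls that take their values in {-1, 0, 1} almost
everywhere (ternary controls).  Let g < 1 be the common value of the phi_j at 1.
By (A2) and (A3), phi_j(r) <= g |r| for |r| <= 1, with equality exactly for r in
{-1, 0, 1}; hence (1 - g) times the L1 norm is at most J, again with equality
exactly for the ternary controls.  So as soon as the minimum of the L1 norm over
the feasible controls is attained by some ternary control, the minimizers of the
L0 norm and those of J are the same controls, namely the ternary ones among the
minimizers of the L1 norm (optimal_tight).

It remains to find a ternary minimizer of the L1 norm (ternary_minimizer).
The pair (A, B) may fail to be normal, and then a minimizer need not be ternary,
but it can be exchanged for a ternary one.  Write each component of a control as the
difference of its positive and negative parts, two densities p with values in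
[0, 1].  What matters of such a density is its moment, the integral of p G, where
G stacks a column of exp(-tA) B and the constant 1: the first coordinates give
the effect on the state, the last one the contribution to the L1 norm.  These
moments belong to a compact convex set, a zonoid, so that some tuple of moments
compatible with the constraint has minimal cost, and by a theorem of Lyapunov
every point of the zonoid is the integral of G over some measurable set, that is
the moment of a density with values in {0, 1}.

The zonoid is encoded by its support function h(l), the integral of the positive
part of l.G, so that it is closed by definition and membership is a family of
inequalities.  Lyapunov's theorem (lyapunov) is proved by induction on the number
of coordinates.  Restrict the domain to times at most s
and decrease s as long as the given point z stays in the zonoid.  At the critical
s some nonzero l satisfies l.z = h(l) (supporting_functional).  Differentiating
h at l shows that, once the part where l.G > 0 has been put in the set, the rest
of z lies in the zonoid of the part where l.G = 0 (zonoid_face), and there one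
coordinate of G is a linear combination of the others. *)

(** * Zonoids and their faces *)

Section BoundedMeasurable.
Context d (X : measurableType d) (R : realType).
Implicit Types f g : X -> R.

Definition bounded_measurable f :=
  measurable_fun setT f /\ exists C, forall x, `|f x| <= C.

Lemma measurable_level_gt0 f : measurable_fun setT f ->
  measurable [set x | 0 < f x].
Proof.
move=> mf; have := mf measurableT `]0, +oo[%classic (measurable_itv _).
rewrite setTI; congr measurable.
by apply/seteqP; split => x /=; rewrite in_itv/= andbT.
Qed.

Lemma measurable_level_eq0 f : measurable_fun setT f ->
  measurable [set x | f x = 0].
Proof.
by move=> mf; have := mf measurableT [set 0] (measurable_set1 _); rewrite setTI.
Qed.

Lemma bounded_measurableD f g : bounded_measurable f -> bounded_measurable g ->
  bounded_measurable (fun x => f x + g x).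
Proof.
move=> [mf [C fC]] [mg [C' gC]]; split; first exact: measurable_funD.
by exists (C + C') => x; rewrite (le_trans (ler_normD _ _))// lerD.
Qed.

Lemma bounded_measurable_cst (c : R) : bounded_measurable (fun=> c).
Proof. by split; [exact: measurable_cst|exists `|c|]. Qed.

Lemma bounded_measurableM f g : bounded_measurable f -> bounded_measurable g ->
  bounded_measurable (fun x => f x * g x).
Proof.
move=> [mf [C fC]] [mg [C' gC]]; split; first exact: measurable_funM.
by exists (C * C') => x; rewrite normrM ler_pM.
Qed.

Lemma bounded_measurable_max f g : bounded_measurable f ->
  bounded_measurable g -> bounded_measurable (fun x => Num.max (f x) (g x)).
Proof.
move=> [mf [C fC]] [mg [C' gC]]; split; first exact: measurable_maxr.
exists (C + C') => x; have := fC x; have := gC x.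
have := normr_ge0 (f x); have := normr_ge0 (g x).
by rewrite /Num.max; case: ifP => _; lra.
Qed.

Lemma bounded_measurable_sum (I : Type) (r : seq I) (f : I -> X -> R) :
  (forall i, bounded_measurable (f i)) ->
  bounded_measurable (fun x => \sum_(i <- r) f i x).
Proof.
move=> bf; elim: r => [|i r IH].
  by under eq_fun do rewrite big_nil; exact: bounded_measurable_cst.
by under eq_fun do rewrite big_cons; exact: bounded_measurableD.
Qed.

Lemma bounded_measurable_patch (E : set X) f : measurable E ->
  bounded_measurable f -> bounded_measurable (f \_ E).
Proof.
move=> mE [mf [C fC]]; split.
  by apply/(measurable_restrictT _ mE); exact: measurable_funTS.
exists C => x; rewrite patchE; case: ifP => // _.
by rewrite normr0 (le_trans _ (fC x)).
Qed.

Context (mu : {measure set X -> \bar R}).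

Lemma bounded_measurable_integrable (D : set X) f : measurable D ->
  (mu D < +oo)%E -> bounded_measurable f -> mu.-integrable D (EFin \o f).
Proof.
move=> mD Dfin [mf [C fC]].
apply: measurable_bounded_integrable => //; first exact: measurable_funTS.
exists C; split; first exact: num_real.
by move=> M CM x _; exact: (le_trans (fC x) (ltW CM)).
Qed.

End BoundedMeasurable.

Section Dot.
Context (R : realType) (k : nat).
Implicit Types l z : 'rV[R]_k.

Definition dot l z : R := \sum_i l ord0 i * z ord0 i.

Lemma dotDl l l' z : dot (l + l') z = dot l z + dot l' z.
Proof. by rewrite -big_split; apply: eq_bigr => i _; rewrite mxE mulrDl. Qed.

Lemma dotZl a l z : dot (a *: l) z = a * dot l z.
Proof. by rewrite mulr_sumr; apply: eq_bigr => i _; rewrite mxE mulrA. Qed.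

Lemma dotDr l z z' : dot l (z + z') = dot l z + dot l z'.
Proof. by rewrite -big_split; apply: eq_bigr => i _; rewrite mxE mulrDr. Qed.

Lemma dotZr a l z : dot l (a *: z) = a * dot l z.
Proof. by rewrite mulr_sumr; apply: eq_bigr => i _; rewrite mxE mulrCA. Qed.

Lemma dotNl l z : dot (- l) z = - dot l z.
Proof. by rewrite -scaleN1r dotZl mulN1r. Qed.

Lemma dotBr l z z' : dot l (z - z') = dot l z - dot l z'.
Proof. by rewrite dotDr -scaleN1r dotZr mulN1r. Qed.

Lemma dot0l z : dot 0 z = 0.
Proof. by rewrite -(scale0r 0) dotZl mul0r. Qed.

Lemma dot_delta i z : dot (delta_mx ord0 i) z = z ord0 i.
Proof.
rewrite /dot (bigD1 i)//= big1 ?addr0; first by rewrite mxE !eqxx mul1r.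
by move=> j ji; rewrite mxE (negPf ji) andbF mul0r.
Qed.

Lemma dot_continuousl z : continuous (dot^~ z).
Proof.
apply: continuous_big => [|i _ l]; first exact: add_continuous.
by apply: cvgMr_tmp; [exact: (nbhs_filter l)|exact: coord_continuous].
Qed.

Lemma dot_continuousr l : continuous (dot l).
Proof.
apply: continuous_big => [|i _ z]; first exact: add_continuous.
by apply: cvgMl_tmp; [exact: (nbhs_filter z)|exact: coord_continuous].
Qed.

End Dot.

Section Zonoid.
Context d (X : measurableType d) (R : realType).
Context (mu : {measure set X -> \bar R}).

Definition vec_integral k (E : set X) (G : X -> 'rV[R]_k) : 'rV[R]_k :=
  \row_i \int[mu]_(x in E) G x ord0 i.

Definition bounded_measurable_rV k (G : X -> 'rV[R]_k) :=
  forall i, bounded_measurable (fun x => G x ord0 i).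

Definition zonoid_support k (D : set X) (G : X -> 'rV[R]_k)
    (l : 'rV[R]_k) : R :=
  \int[mu]_(x in D) Num.max (dot l (G x)) 0.

(** This is the closed convex hull of the integrals of [G] over the measurable
subsets of [D], described by the half-spaces that contain it. *)
Definition zonoid k (D : set X) (G : X -> 'rV[R]_k) : set 'rV[R]_k :=
  [set z | forall l, dot l z <= zonoid_support D G l].

Lemma bounded_measurable_dot k (G : X -> 'rV[R]_k) l :
  bounded_measurable_rV G -> bounded_measurable (fun x => dot l (G x)).
Proof.
move=> bG; apply: bounded_measurable_sum => i.
by apply: bounded_measurableM => //; exact: bounded_measurable_cst.
Qed.

Lemma dot_vec_integral k (E : set X) (G : X -> 'rV[R]_k) l :
  measurable E -> (mu E < +oo)%E -> bounded_measurable_rV G ->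
  dot l (vec_integral E G) = \int[mu]_(x in E) dot l (G x).
Proof.
move=> mE Efin bG; rewrite /dot /Rintegral.
under [in RHS]eq_integral do rewrite -sumEFin.
have bc i : bounded_measurable (fun x => l ord0 i * G x ord0 i).
  by apply: bounded_measurableM => //; exact: bounded_measurable_cst.
have intg f : bounded_measurable f -> mu.-integrable E (EFin \o f).
  by move=> ?; exact: bounded_measurable_integrable.
rewrite integral_sum//=; last by move=> i; exact: intg.
rewrite -sum_fine; last by move=> i _; exact: integrable_fin_num (intg _ (bc i)).
by apply: eq_bigr => i _; rewrite mxE -RintegralZl//; exact: intg (bG i).
Qed.

Context k (D : set X) (G : X -> 'rV[R]_k).
Hypotheses (mD : measurable D) (Dfin : (mu D < +oo)%E).
Hypothesis bG : bounded_measurable_rV G.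

Let sub_fin E : measurable E -> E `<=` D -> (mu E < +oo)%E.
Proof. by move=> mE ED; rewrite (le_lt_trans _ Dfin)// le_measure ?inE. Qed.

Let bm_pos l : bounded_measurable (fun x => Num.max (dot l (G x)) 0).
Proof.
apply: bounded_measurable_max; first exact: bounded_measurable_dot.
exact: bounded_measurable_cst.
Qed.

Lemma support_ge0 l : 0 <= zonoid_support D G l.
Proof. by apply: Rintegral_ge0 => x _; rewrite le_max lexx orbT. Qed.

Lemma supportZ a l : 0 <= a ->
  zonoid_support D G (a *: l) = a * zonoid_support D G l.
Proof.
move=> a0; rewrite -RintegralZl//; last exact: bounded_measurable_integrable.
by apply: eq_Rintegral => x _; rewrite dotZl maxr_pMr// mulr0.
Qed.

(** Among the subsets of [D], the one where [dot l (G x)] is positive gives the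
integral that is extremal in the direction [l]. *)
Lemma supportE l : zonoid_support D G l =
  dot l (vec_integral (D `&` [set x | 0 < dot l (G x)]) G).
Proof.
have mE : measurable (D `&` [set x | 0 < dot l (G x)]).
  apply: measurableI => //; apply: measurable_level_gt0.
  by have [] := bounded_measurable_dot l bG.
rewrite dot_vec_integral//; last exact: sub_fin.
rewrite Rintegral_mkcondr.
apply: eq_Rintegral => x _; rewrite patchE; case: ifPn => [/set_mem/= h|/negP h].
  by rewrite max_l// ltW.
by rewrite max_r// leNgt; apply/negP => h'; apply: h; exact/mem_set.
Qed.

Lemma dot_vec_integral_le_support E l : measurable E -> E `<=` D ->
  dot l (vec_integral E G) <= zonoid_support D G l.
Proof.
move=> mE ED; rewrite dot_vec_integral//; last exact: sub_fin.
have -> : E = D `&` E by rewrite setIC; apply/esym/setIidl.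
rewrite Rintegral_mkcondr; apply: le_Rintegral => //.
- apply: bounded_measurable_integrable => //.
  by apply: bounded_measurable_patch => //; exact: bounded_measurable_dot.
- exact: bounded_measurable_integrable.
- move=> x _; rewrite patchE; case: ifP => _; first by rewrite le_max lexx.
  by rewrite le_max lexx orbT.
Qed.

(** The support function is a supremum of linear functions of [l], one for each
subset of [D], so that this set is an intersection of half-spaces. *)
Lemma closed_support_le z : closed [set l | zonoid_support D G l <= dot l z].
Proof.
rewrite (_ : [set _ | _] = \bigcap_(E in [set E | measurable E /\ E `<=` D])
   [set l | 0 <= dot l (z - vec_integral E G)]); last first.
  apply/seteqP; split => l /=.
    move=> h E [mE ED]; rewrite /= dotBr subr_ge0 (le_trans _ h)//.
    exact: dot_vec_integral_le_support.
  have mE : measurable (D `&` [set x | 0 < dot l (G x)]).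
    apply: measurableI => //; apply: measurable_level_gt0.
    by have [] := bounded_measurable_dot l bG.
  move=> /(_ (D `&` [set x | 0 < dot l (G x)])) /=.
  by rewrite dotBr subr_ge0 supportE; apply; split.
apply: closed_bigI => E _.
apply: (preimage_closed _ (@closed_ge R 0)) => l _; exact: dot_continuousl.
Qed.

Lemma closed_zonoid : closed (zonoid D G).
Proof.
rewrite (_ : zonoid D G =
    \bigcap_l [set z | dot l z <= zonoid_support D G l]); last first.
  by apply/seteqP; split => z /= h l; [move=> _; exact: h|exact: (h l I)].
apply: closed_bigI => l _.
apply: (preimage_closed _ (@closed_le R _)) => z _; exact: dot_continuousr.
Qed.

End Zonoid.

Lemma max0_diff_quotient_bound (R : realType) (a b e : R) : 0 < e ->
  `|(Num.max (a + e * b) 0 - Num.max a 0) / e| <= `|b|.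
Proof.
move=> e0; rewrite normrM normfV (gtr0_norm e0) ler_pdivrMr// [leRHS]mulrC.
rewrite (_ : e * `|b| = `|e * b|); last by rewrite normrM gtr0_norm.
move: (e * b) => c {b e e0}.
have c1 := ler_norm c; have c2 := ler_norm (- c); rewrite normrN in c2.
by case: (ltrP (a + c) 0) => ?; case: (ltrP a 0) => ?;
  rewrite ler_norml; apply/andP; split; lra.
Qed.

(** Directional derivative of the positive part at [a] along [b]: for small steps
the quotient is not only close to its limit but equal to it. *)
Lemma max0_diff_quotient_near (R : realType) (a b : R) :
  \forall n \near \oo,
    (Num.max (a + n.+1%:R^-1 * b) 0 - Num.max a 0) / n.+1%:R^-1
    = if 0 < a then b else if a == 0 then Num.max b 0 else 0.
Proof.
have e0 n : 0 < n.+1%:R^-1 :> R by rewrite invr_gt0.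
have small c : 0 < c -> \forall n \near \oo, n.+1%:R^-1 * `|b| < c :> R.
  move=> c0; have b1 : 0 < `|b| + 1 by rewrite ltr_wpDl.
  near=> n; apply: (@le_lt_trans _ _ (n.+1%:R^-1 * (`|b| + 1))).
    by rewrite ler_wpM2l ?lerDl// ltW.
  rewrite -ltr_pdivlMr//; near: n.
  by apply: near_infty_natSinv_lt (PosNum (divr_gt0 c0 b1)).
have bnd n : - (n.+1%:R^-1 * `|b|) <= n.+1%:R^-1 * b <= n.+1%:R^-1 * `|b|.
  have := ler_norm b; have := ler_norm (- b); rewrite normrN => c1 c2.
  rewrite -mulrN; apply/andP.
  by split; apply: ler_wpM2l; [exact: ltW|lra|exact: ltW|lra].
have [a0|a0|<-] := ltgtP 0 a.
- near=> n; have nb : n.+1%:R^-1 * `|b| < a by near: n; exact: small.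
  have /andP[h1 h2] := bnd n.
  rewrite max_l; last by rewrite -lerBlDl sub0r (le_trans _ h1)// lerN2 ltW.
  by rewrite addrAC subrr add0r mulrAC mulfV ?mul1r// gt_eqF.
- near=> n; have nb : n.+1%:R^-1 * `|b| < - a.
    by near: n; apply: small; rewrite oppr_gt0.
  have /andP[h1 h2] := bnd n.
  rewrite max_r; last by rewrite -lerBrDl sub0r (le_trans h2)// ltW.
  by rewrite subrr mul0r.
- near=> n; rewrite add0r subr0 -[X in Num.max _ X](mulr0 n.+1%:R^-1).
  by rewrite -maxr_pMr 1?ltW// mulrAC mulfV ?mul1r// gt_eqF.
Unshelve. all: by end_near. Qed.

Section ZonoidFaces.
Context d (X : measurableType d) (R : realType).
Context (mu : {measure set X -> \bar R}).
Context k (D : set X) (G : X -> 'rV[R]_k).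
Hypotheses (mD : measurable D) (Dfin : (mu D < +oo)%E).
Hypothesis bG : bounded_measurable_rV G.

Lemma density_zonoid (p : X -> R) : measurable_fun setT p ->
  (forall x, 0 <= p x <= 1) ->
  zonoid mu D G (vec_integral mu D (fun x => p x *: G x)).
Proof.
move=> mp p01 l.
have bp : bounded_measurable p.
  split=> //; exists 1 => x; have /andP[p0 p1] := p01 x.
  by rewrite ger0_norm.
have bpG : bounded_measurable_rV (fun x => p x *: G x).
  move=> i; under eq_fun do rewrite mxE.
  exact: bounded_measurableM (bG i).
rewrite dot_vec_integral//; apply: le_Rintegral => //.
- apply: bounded_measurable_integrable => //; exact: bounded_measurable_dot.
- apply: bounded_measurable_integrable => //; apply: bounded_measurable_max.
    exact: bounded_measurable_dot.
  exact: bounded_measurable_cst.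
- move=> x _; rewrite dotZr; have /andP[p0 p1] := p01 x.
  case: (lerP 0 (dot l (G x))) => [a0|/ltW a0].
    by rewrite ler_piMl.
  by rewrite mulr_ge0_le0.
Qed.

(** As [z] lies in the zonoid and touches its support function [h] at [l], every
[m] satisfies [m.z <= (h (l + e m) - h l) / e] for [e > 0].  When [e] tends to 0
the right-hand side tends, by dominated convergence, to the integral of [m.G]
over the part where [l.G > 0] plus that of the positive part of [m.G] over the
part where [l.G = 0]. *)
Lemma zonoid_face z l : zonoid mu D G z -> dot l z = zonoid_support mu D G l ->
  zonoid mu (D `&` [set x | dot l (G x) = 0]) G
    (z - vec_integral mu (D `&` [set x | 0 < dot l (G x)]) G).
Proof.
move=> zz lz m.
set Dp := D `&` _; set D0 := D `&` _.
have bl l' : bounded_measurable (fun x => dot l' (G x)).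
  exact: bounded_measurable_dot.
have bmax f : bounded_measurable f ->
    bounded_measurable (fun x => Num.max (f x) (0 : R)).
  move=> bf; apply: bounded_measurable_max => //.
  exact: bounded_measurable_cst.
have mDp : measurable Dp.
  by apply: measurableI => //; apply: measurable_level_gt0; have [] := bl l.
have mD0 : measurable D0.
  by apply: measurableI => //; apply: measurable_level_eq0; have [] := bl l.
pose fn n x := (Num.max (dot l (G x) + n.+1%:R^-1 * dot m (G x)) 0
  - Num.max (dot l (G x)) 0) / (n.+1%:R^-1 : R).
pose Sp := [set x | 0 < dot l (G x)]; pose S0 := [set x | dot l (G x) = 0].
pose fp := (fun x => dot m (G x)) \_ Sp.
pose f0 := (fun x => Num.max (dot m (G x)) 0) \_ S0.
pose f x := fp x + f0 x.
have fE x : f x = if 0 < dot l (G x) then dot m (G x)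
    else if dot l (G x) == 0 then Num.max (dot m (G x)) 0 else 0.
  rewrite /f /fp /f0 !patchE /=.
  have -> : (x \in Sp) = (0 < dot l (G x)).
    by apply/idP/idP => [/set_mem|/mem_set].
  have -> : (x \in S0) = (dot l (G x) == 0).
    by apply/idP/eqP => [/set_mem|/mem_set].
  by case: ltgtP => _ //; rewrite ?addr0 ?add0r.
have e0 n : 0 < n.+1%:R^-1 :> R by rewrite invr_gt0.
have bfn n : bounded_measurable (fn n).
  apply: bounded_measurableM; last exact: bounded_measurable_cst.
  apply: bounded_measurableD.
    apply: bmax; apply: bounded_measurableD => //.
    by apply: bounded_measurableM => //; exact: bounded_measurable_cst.
  under eq_fun do rewrite -mulN1r.
  apply: bounded_measurableM; last exact: bmax.
  exact: bounded_measurable_cst.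
have intg g : bounded_measurable g -> mu.-integrable D (EFin \o g).
  by move=> ?; exact: bounded_measurable_integrable.
(* Difference quotient of the support function, with step 1 / (n + 1). *)
have le_fn n : ((dot m z)%:E <= \int[mu]_(x in D) (fn n x)%:E)%E.
  rewrite -[leRHS]fineK; last exact: integrable_fin_num (intg _ (bfn n)).
  rewrite lee_fin -[fine _]/(\int[mu]_(x in D) fn n x).
  rewrite /fn RintegralZr//; last first.
    apply/intg/bounded_measurableD; last first.
      under eq_fun do rewrite -mulN1r.
      apply: bounded_measurableM; last exact: bmax.
      exact: bounded_measurable_cst.
    apply: bmax; apply: bounded_measurableD => //.
    by apply: bounded_measurableM => //; exact: bounded_measurable_cst.
  rewrite ler_pdivlMr// RintegralB//; last 2 first.
  - apply/intg/bmax; apply: bounded_measurableD => //.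
    by apply: bounded_measurableM => //; exact: bounded_measurable_cst.
  - exact/intg/bmax.
  rewrite -[X in _ <= _ - X]/(zonoid_support mu D G l) -lz lerBrDr mulrC.
  rewrite -dotZl -dotDl addrC (le_trans (zz _))//.
  by under [leRHS]eq_Rintegral do rewrite -dotZl -dotDl.
have cvg_fn : (\int[mu]_(x in D) (fn n x)%:E @[n --> \oo] -->
    \int[mu]_(x in D) (f x)%:E)%E.
  apply: (@dominated_cvg _ _ _ mu D mD _ _ (fun x => `|dot m (G x)|%:E)) => //.
  - by move=> n; apply/measurable_EFinP/measurable_funTS; have [] := bfn n.
  - move=> x _; apply: cvg_near_cst.
    have := max0_diff_quotient_near (dot l (G x)) (dot m (G x)).
    by apply: filterS => n; rewrite /fn fE => ->.
  - exact: (integrable_norm (intg _ (bl m))).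
  - by move=> n x _; rewrite lee_fin; exact: max0_diff_quotient_bound.
have bfp : bounded_measurable fp.
  apply: bounded_measurable_patch; last exact: bl.
  by apply: measurable_level_gt0; have [] := bl l.
have bf0 : bounded_measurable f0.
  apply: bounded_measurable_patch; last exact: bmax.
  by apply: measurable_level_eq0; have [] := bl l.
have bf : bounded_measurable f by exact: bounded_measurableD.
have : ((dot m z)%:E <= \int[mu]_(x in D) (f x)%:E)%E.
  by apply: (cvge_ge _ cvg_fn); near=> n.
rewrite -[leRHS]fineK; last exact: integrable_fin_num (intg _ bf).
rewrite lee_fin -[fine _]/(\int[mu]_(x in D) f x).
rewrite RintegralD//; try exact: intg.
rewrite -!Rintegral_mkcondr dotBr dot_vec_integral//; last first.
  apply: (le_lt_trans _ Dfin); apply: le_measure; rewrite ?inE//.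
  exact: subIsetl.
by rewrite lerBlDl; exact: id.
Unshelve. all: by end_near. Qed.

End ZonoidFaces.

(** * Lyapunov's theorem *)

(** The function [tau] plays the role of time: the part of a domain where
[tau x <= s] grows continuously in measure with [s], so that [mu] has no atoms. *)
Section Lyapunov.
Context d (X : measurableType d) (R : realType).
Context (mu : {measure set X -> \bar R}) (tau : X -> R).
Hypothesis mtau : measurable_fun setT tau.
Hypothesis mu_tau : forall s t, s <= t ->
  (mu [set x | s < tau x <= t]%R <= (t - s)%:E)%E.

Let measurable_until s : measurable [set x | tau x <= s].
Proof.
have := mtau measurableT (measurable_itv `]-oo, s]); rewrite setTI.
by congr measurable; apply/seteqP; split => x /=; rewrite in_itv.
Qed.

Let measurable_between s t : measurable [set x | s < tau x <= t].
Proof.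
have := mtau measurableT (measurable_itv `]s, t]); rewrite setTI.
by congr measurable; apply/seteqP; split => x /=; rewrite in_itv.
Qed.

Lemma clock_finite a b (D : set X) : a <= b -> measurable D ->
  D `<=` [set x | a < tau x <= b] -> (mu D < +oo)%E.
Proof.
move=> ab mD Dab; apply: (le_lt_trans _ (ltry (b - a))).
by apply: (le_trans _ (mu_tau ab)); apply: le_measure; rewrite ?inE.
Qed.

Section Growth.
Context k (D : set X) (G : X -> 'rV[R]_k).
Hypotheses (mD : measurable D) (Dfin : (mu D < +oo)%E).
Hypothesis bG : bounded_measurable_rV G.

Let until s := D `&` [set x | tau x <= s].

Let muntil s : measurable (until s). Proof. exact: measurableI. Qed.

Let until_fin s : (mu (until s) < +oo)%E.
Proof.
apply: (le_lt_trans _ Dfin); apply: le_measure; rewrite ?inE//.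
exact: subIsetl.
Qed.

Let bpos l : bounded_measurable (fun x => Num.max (dot l (G x)) 0).
Proof.
apply: bounded_measurable_max; first exact: bounded_measurable_dot.
exact: bounded_measurable_cst.
Qed.

Let supportU s t l : s <= t -> zonoid_support mu (until t) G l =
  zonoid_support mu (until s) G l +
  zonoid_support mu (D `&` [set x | s < tau x <= t]) G l.
Proof.
move=> st; have -> : until t = until s `|` (D `&` [set x | s < tau x <= t]).
  apply/seteqP; split => x /=.
    by move=> [Dx xt]; case: (leP (tau x) s) => xs; [left|right; rewrite /= xt].
  move=> [[Dx xs]|[Dx /andP[_ xt]]]; split => //=.
  exact: le_trans xs st.
apply: Rintegral_setU => //; first exact: measurableI.
  apply: bounded_measurable_integrable => //.
    by apply: measurableU => //; exact: measurableI.
  apply: (le_lt_trans _ Dfin); apply: le_measure; rewrite ?inE//.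
    by apply: measurableU => //; exact: measurableI.
  by rewrite subUset; split; exact: subIsetl.
apply/disj_setPS => x /= [[_ xs] [_ /andP[]]].
by rewrite ltNge xs.
Qed.

Lemma support_until_mono s t l : s <= t ->
  zonoid_support mu (until s) G l <= zonoid_support mu (until t) G l.
Proof. by move=> st; rewrite (supportU l st) lerDl support_ge0. Qed.

Lemma support_until_lipschitz l : exists2 C, 0 <= C & forall s t, s <= t ->
  zonoid_support mu (until t) G l <=
  zonoid_support mu (until s) G l + C * (t - s).
Proof.
have [mf [C fC]] := bpos l; exists `|C| => // s t st.
rewrite (supportU l st) lerD2l.
have mI : measurable (D `&` [set x | s < tau x <= t]) by exact: measurableI.
have muI : (mu (D `&` [set x | s < tau x <= t]%R) <= (t - s)%:E)%E.
  by apply: le_trans (mu_tau st); apply: le_measure; rewrite ?inE.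
have Ifin : (mu (D `&` [set x | s < tau x <= t]%R) < +oo)%E.
  exact: le_lt_trans muI (ltry _).
apply: (@le_trans _ _ (\int[mu]_(x in D `&` [set x | s < tau x <= t]) `|C|)).
  apply: le_Rintegral => //.
  - exact: bounded_measurable_integrable.
  - apply: bounded_measurable_integrable => //.
    exact: bounded_measurable_cst.
  - move=> x _; rewrite (le_trans (ler_norm _))// (le_trans (fC x))//.
    exact: ler_norm.
rewrite Rintegral_cst// ler_wpM2l// -lee_fin fineK// ge0_fin_numE//.
Qed.

(** For every fixed direction the support function is continuous in time. *)
Lemma zonoid_until_inf z (S : set R) : S !=set0 -> has_lbound S ->
  (forall s, S s -> zonoid mu (until s) G z) -> zonoid mu (until (inf S)) G z.
Proof.
move=> S0 Slb Sz l; have [C C0 hC] := support_until_lipschitz l.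
apply/ler_addgt0Pr => e e0.
have C1 : 0 < C + 1 by rewrite ltr_wpDl.
have [s Ss se] := inf_adherent (divr_gt0 e0 C1) (conj S0 Slb).
apply: (le_trans (Sz s Ss l)).
apply: (le_trans (hC _ _ (ge_inf Slb Ss))); rewrite lerD2l.
have h : s - inf S <= e / (C + 1) by rewrite lerBlDl ltW.
have h0 : 0 <= s - inf S by rewrite subr_ge0; exact: ge_inf.
rewrite (@le_trans _ _ ((C + 1) * (s - inf S)))//.
  by rewrite ler_wpM2r// lerDl.
by rewrite mulrC -ler_pdivlMr.
Qed.

(** For [s < b] the point [z] is separated from the zonoid up to time [s] by some
unit vector.  When [s] tends to [b] these vectors have a cluster point [l] on the
compact unit sphere.  As the support functions increase with time, [l] still
satisfies the weak inequality at every time [s < b], hence at [b] by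
continuity. *)
Lemma supporting_functional z a b : a < b -> zonoid mu (until b) G z ->
  (forall s, a <= s < b -> ~ zonoid mu (until s) G z) ->
  exists2 l, l != 0 & dot l z = zonoid_support mu (until b) G l.
Proof.
move=> ab zb nz.
have : forall s, exists l : 'rV[R]_k, a <= s < b ->
    `|l| = 1 /\ zonoid_support mu (until s) G l <= dot l z.
  move=> s; have [sab|] := boolP (a <= s < b); last by exists 0.
  have /existsNP[l /negP] := nz s sab; rewrite -ltNge => lz.
  have l0 : l != 0.
    apply/eqP => l0; move: lz; rewrite l0 dot0l ltNge.
    by rewrite support_ge0.
  have nl0 : 0 < `|l| by rewrite normr_gt0.
  exists (`|l|^-1 *: l) => _; split.
    by rewrite normrZ normfV normr_id mulVf// gt_eqF.
  rewrite dotZl supportZ// ?invr_ge0//.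
  by rewrite ler_wpM2l ?invr_ge0// ltW.
move=> /choice[lf lfP].
have cK : compact [set l : 'rV[R]_k | `|l| = 1].
  apply: bounded_closed_compact.
    by exists 1; split => // M M1 l /= ->; exact: ltW.
  by apply: (preimage_closed _ (@closed_eq R 1)) => l _; exact: norm_continuous.
have [] := cK (lf @ b^'-) _ _.
  change (\forall s \near b^'-, `|lf s| = 1).
  near=> s; have /lfP[] // : a <= s < b.
  by apply/andP; split; near: s; [exact: nbhs_left_ge|exact: nbhs_left_lt].
move=> l [l1 cl].
have ls s : a <= s < b -> zonoid_support mu (until s) G l <= dot l z.
  move=> /andP[sa sb].
  have := closed_support_le (muntil s) (until_fin s) bG (z := z).
  apply => B lB; apply: cl lB.
  change (\forall t \near b^'-,
    zonoid_support mu (until s) G (lf t) <= dot (lf t) z).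
  near=> t.
  have st : s <= t by near: t; exact: nbhs_left_ge.
  rewrite /= (le_trans (support_until_mono _ st))//.
  have /lfP[] // : a <= t < b.
  by rewrite (le_trans sa st)/=; near: t; exact: nbhs_left_lt.
exists l; first by rewrite -normr_gt0 l1.
apply/le_anti; rewrite zb/=.
have [C C0 hC] := support_until_lipschitz l.
apply/ler_addgt0Pr => e e0.
have C1 : 0 < C + 1 by rewrite ltr_wpDl.
(* Close enough to [b] for the support function to grow by at most [e]. *)
pose s := Num.max a (b - e / (C + 1)).
have sab : a <= s < b.
  by rewrite le_max lexx/= gt_max ab/= ltrBlDr ltrDl divr_gt0.
have /andP[_ /ltW sb] := sab.
apply: (le_trans (hC _ _ sb)); apply: lerD; first exact: ls.
have h : b - s <= e / (C + 1) by rewrite lerBlDr -lerBlDl le_max lexx orbT.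
have h0 : 0 <= b - s by rewrite subr_ge0.
rewrite (@le_trans _ _ ((C + 1) * (b - s)))//.
  by rewrite ler_wpM2r// lerDl.
by rewrite mulrC -ler_pdivlMr.
Unshelve. all: by end_near. Qed.

End Growth.

(** Induction on the number [k] of coordinates.  At the smallest time [t] for which
[z] is in the zonoid up to [t], either nothing has been swept yet and [z = 0], or
[z] is on the boundary; then [E] consists of the part where [l.G > 0] and of a
subset of the part where [l.G = 0], given by the induction hypothesis after the
removal of a coordinate [i] such that [l i] is nonzero. *)
Theorem lyapunov k (D : set X) (G : X -> 'rV[R]_k) (z : 'rV[R]_k) a b :
  a <= b -> measurable D -> D `<=` [set x | a < tau x <= b] ->
  bounded_measurable_rV G -> zonoid mu D G z ->
  exists E, [/\ measurable E, E `<=` D & z = vec_integral mu E G].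
Proof.
move=> ab; elim: k D G z => [|k IH] D G z mD Dab bG zD.
  by exists set0; split => //; apply/rowP => -[].
have Dfin : (mu D < +oo)%E by exact: clock_finite Dab.
pose until s := D `&` [set x | tau x <= s].
have muntil s : measurable (until s) by exact: measurableI.
have Db : until b = D.
  apply/seteqP; split => x; first by case.
  by move=> Dx; split => //; case/andP: (Dab _ Dx).
have Da : until a = set0.
  apply/seteqP; split => x // [/Dab/andP[+ _] /=].
  by move=> ax xa; move: ax; rewrite ltNge xa.
pose S := [set s | a <= s /\ zonoid mu (until s) G z].
have Sb : S b by split => //; rewrite Db.
have Slb : has_lbound S by exists a => s [].
have S0 : S !=set0 by exists b.
pose t := inf S.
have ta : a <= t by apply: lb_le_inf => // s [].
have tz : zonoid mu (until t) G z.
  by apply: zonoid_until_inf => // s [].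
have nz s : a <= s < t -> ~ zonoid mu (until s) G z.
  move=> /andP[sa st] zs; move: st; rewrite ltNge => /negP; apply.
  by apply: ge_inf.
move: ta; rewrite le_eqVlt => /predU1P[at_|a_lt_t].
  exists set0; split => //; apply/rowP => i; rewrite mxE Rintegral_set0.
  have supp0 l : zonoid_support mu (until t) G l = 0.
    by rewrite -at_ Da /zonoid_support Rintegral_set0.
  apply/le_anti/andP; split.
    by rewrite -(dot_delta i) (le_trans (tz _))// supp0.
  by rewrite -oppr_le0 -(dot_delta i) -dotNl (le_trans (tz _))// supp0.
have tfin : (mu (until t) < +oo)%E.
  apply: (le_lt_trans _ Dfin); apply: le_measure; rewrite ?inE//.
  exact: subIsetl.
have [l l0 lz] := supporting_functional mD Dfin bG a_lt_t tz nz.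
have [mdot _] := bounded_measurable_dot l bG.
have zf := zonoid_face (muntil t) tfin bG tz lz.
set Dp := until t `&` [set x | 0 < dot l (G x)] in zf.
set D0 := until t `&` [set x | dot l (G x) = 0] in zf.
have mDp : measurable Dp.
  by apply: measurableI => //; exact: measurable_level_gt0.
have mD0 : measurable D0.
  by apply: measurableI => //; exact: measurable_level_eq0.
set z' := z - vec_integral mu Dp G in zf.
have [i li] : exists i, l ord0 i != 0.
  by move: l0 => /rV0Pn[i]; exists i.
have lz' : dot l z' = 0.
  have supp0 m : (forall x, D0 x -> dot m (G x) = 0) ->
      zonoid_support mu D0 G m = 0.
    move=> m0; rewrite /zonoid_support; under eq_Rintegral => x xD0.
      rewrite (m0 _ (set_mem xD0)) maxxx; over.
    by rewrite Rintegral_cst// mul0r.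
  apply/le_anti/andP; split.
    by rewrite (le_trans (zf l))// supp0// => x [].
  rewrite -oppr_le0 -dotNl (le_trans (zf _))// supp0// => x [_ /=].
  by rewrite dotNl => ->; rewrite oppr0.
(* Removal of the coordinate [i], and the transposed insertion of a zero. *)
pose drop (v : 'rV[R]_k.+1) : 'rV[R]_k := \row_j v ord0 (lift i j).
pose ins (m : 'rV[R]_k) : 'rV[R]_k.+1 :=
  \row_j if unlift i j is Some j' then m ord0 j' else 0.
have dot_ins m v : dot (ins m) v = dot m (drop v).
  rewrite /dot (bigD1_ord i)//= mxE unlift_none mul0r add0r.
  by apply: eq_bigr => j _; rewrite !mxE liftK.
(* On the hyperplane orthogonal to [l] the coordinate [i] is determined by the
   other ones. *)
have dot_drop v : dot l v = 0 ->
    v ord0 i = - (l ord0 i)^-1 * dot (drop l) (drop v).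
  rewrite {1}/dot (bigD1_ord i)//= => /eqP; rewrite addr_eq0 => /eqP h.
  rewrite mulNr -mulrN; apply: (mulfI li); rewrite mulVKf// h; congr (- _).
  by apply: eq_bigr => j _; rewrite !mxE.
have [||||E [mE ED0 Ez]] := IH D0 (drop \o G) (drop z') => //.
- by move=> x [[Dx _] _]; exact: Dab.
- by move=> j; under eq_fun do rewrite mxE; exact: bG.
- move=> m; rewrite -dot_ins (le_trans (zf _))// /zonoid_support.
  by under eq_Rintegral do rewrite dot_ins.
have Efin A : measurable A -> A `<=` until t -> (mu A < +oo)%E.
  by move=> mA At; apply: (le_lt_trans _ tfin); apply: le_measure; rewrite ?inE.
have EUD : E `<=` until t by move=> x /ED0 [].
have DpU : Dp `<=` until t by move=> x [].
have z'E : z' = vec_integral mu E G.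
  have lE : dot l (vec_integral mu E G) = 0.
    rewrite dot_vec_integral//; last exact: Efin.
    under eq_Rintegral => x xE do rewrite (ED0 _ (set_mem xE)).2.
    by rewrite Rintegral_cst// mul0r.
  have dE : drop z' = drop (vec_integral mu E G).
    rewrite Ez; apply/rowP => j; rewrite !mxE.
    by under eq_Rintegral do rewrite /= mxE.
  apply/rowP => j; case: (unliftP i j) => [j' ->|->].
    by move/rowP : dE => /(_ j'); rewrite !mxE.
  by rewrite (dot_drop _ lz') (dot_drop _ lE) dE.
exists (Dp `|` E); split; first exact: measurableU.
  by rewrite subUset; split => x; [move/DpU => []|move/EUD => []].
apply/rowP => j; rewrite mxE Rintegral_setU//; last first.
- apply/disj_setPS => x [[_ /= xp] /ED0[_ /= x0]].
  by rewrite x0 ltxx in xp.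
- apply: bounded_measurable_integrable => //; first exact: measurableU.
  by apply: Efin; [exact: measurableU|rewrite subUset].
move/rowP : z'E => /(_ j); rewrite !mxE => <-.
by rewrite addrC addrA subrr add0r.
Qed.

End Lyapunov.

(** * Ternary controls of minimal L1 norm *)

Lemma mx_coord_continuous (T : topologicalType) m n i j :
  continuous (fun M : 'M[T]_(m, n) => M i j).
Proof.
move=> M B MB.
exists (fun i' j' => if (i' == i) && (j' == j) then B else setT).
  by move=> i' j'; case: ifP => [/andP[/eqP-> /eqP->] //|_]; exact: filterT.
by move=> N /(_ i j); rewrite !eqxx.
Qed.

Section Ternary.
Context d (X : measurableType d) (R : realType).
Context (mu : {measure set X -> \bar R}) (tau : X -> R).
Hypothesis mtau : measurable_fun setT tau.
Hypothesis mu_tau : forall s t, s <= t ->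
  (mu [set x | s < tau x <= t]%R <= (t - s)%:E)%E.
Context (a b : R) (H : set X).
Hypotheses (ab : a <= b) (mH : measurable H).
Hypothesis Hab : H `<=` [set x | a < tau x <= b].

Let Hfin : (mu H < +oo)%E.
Proof. exact: (clock_finite mtau mu_tau ab mH Hab). Qed.

(** The value of the support function at plus or minus a basis vector bounds the
corresponding coordinate. *)
Lemma compact_zonoid k (G : X -> 'rV[R]_k) : bounded_measurable_rV G ->
  compact (zonoid mu H G).
Proof.
move=> bG; apply: bounded_closed_compact; last exact: closed_zonoid.
pose C := \sum_i (zonoid_support mu H G (delta_mx ord0 i)
  + zonoid_support mu H G (- delta_mx ord0 i)).
have s0 l : 0 <= zonoid_support mu H G l by exact: support_ge0.
exists C; split; first exact: num_real.
move=> M CM z zz; rewrite /= [`|z|]mx_normrE.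
have C0 : 0 <= C by apply: sumr_ge0 => i _; rewrite addr_ge0.
apply: bigmax_le => [|[i' i] _ /=]; first exact: ltW (le_lt_trans C0 CM).
rewrite (ord1 i') (le_trans _ (ltW CM))// /C (bigD1 i)//=.
rewrite (@le_trans _ _ (zonoid_support mu H G (delta_mx ord0 i)
  + zonoid_support mu H G (- delta_mx ord0 i)))//; last first.
  by rewrite lerDl; apply: sumr_ge0 => j _; rewrite addr_ge0.
have := zz (delta_mx ord0 i); have := zz (- delta_mx ord0 i).
rewrite dotNl dot_delta => h1 h2.
have := s0 (delta_mx ord0 i); have := s0 (- delta_mx ord0 i) => h3 h4.
by rewrite ler_norml; apply/andP; split; lra.
Qed.

Context (n m : nat) (K : 'I_m -> X -> 'rV[R]_n) (c : 'rV[R]_n).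
Hypothesis bK : forall j, bounded_measurable_rV (K j).

(** The bound is imposed at every point, not almost everywhere, in order that the
positive and negative parts be densities with values in [0, 1]. *)
Definition steering (u : 'I_m -> X -> R) :=
  [/\ forall j, measurable_fun setT (u j),
      forall j x, `|u j x| <= 1
    & \sum_j vec_integral mu H (fun x => u j x *: K j x) = c].

(** The integral of the constant last coordinate over a set is the measure of this
set, which is the cost of acting there. *)
Let G j x : 'rV[R]_(n + 1) := row_mx (K j x) (const_mx 1).

Let bG j : bounded_measurable_rV (G j).
Proof.
move=> i; rewrite /G; case: (split_ordP i) => i' ->.
  by under eq_fun do rewrite row_mxEl; exact: bK.
under eq_fun do rewrite row_mxEr mxE; exact: bounded_measurable_cst.
Qed.

Let moments := ('rV['rV[R]_(n + 1)]_m * 'rV['rV[R]_(n + 1)]_m)%type.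

(** Moments of the positive and of the negative parts of the components, subject to
the steering constraint. *)
Let Theta : set moments := [set M : moments |
  ((forall j, zonoid mu H (G j) (M.1 ord0 j)) /\
   (forall j, zonoid mu H (G j) (M.2 ord0 j))) /\
  forall i, \sum_j ((M.1 ord0 j) ord0 (lshift 1 i) -
                    (M.2 ord0 j) ord0 (lshift 1 i)) = c ord0 i].

Let cost (M : moments) : R :=
  \sum_j ((M.1 ord0 j) ord0 (rshift n ord0) +
          (M.2 ord0 j) ord0 (rshift n ord0)).

Let coord1_continuous j i : continuous (fun M : moments => (M.1 ord0 j) ord0 i).
Proof.
move=> M; apply: (@continuous_comp _ _ _ (fun M : moments => M.1)
  (fun N : 'rV['rV[R]_(n + 1)]_m => N ord0 j ord0 i)); first exact: cvg_fst.
apply: (@continuous_comp _ _ _ (fun N : 'rV['rV[R]_(n + 1)]_m => N ord0 j)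
  (fun v : 'rV[R]_(n + 1) => v ord0 i)); first exact: mx_coord_continuous.
exact: coord_continuous.
Qed.

Let coord2_continuous j i : continuous (fun M : moments => (M.2 ord0 j) ord0 i).
Proof.
move=> M; apply: (@continuous_comp _ _ _ (fun M : moments => M.2)
  (fun N : 'rV['rV[R]_(n + 1)]_m => N ord0 j ord0 i)); first exact: cvg_snd.
apply: (@continuous_comp _ _ _ (fun N : 'rV['rV[R]_(n + 1)]_m => N ord0 j)
  (fun v : 'rV[R]_(n + 1) => v ord0 i)); first exact: mx_coord_continuous.
exact: coord_continuous.
Qed.

Let compact_Theta : compact Theta.
Proof.
pose W := [set N : 'rV['rV[R]_(n + 1)]_m |
  forall j, zonoid mu H (G j) (N ord0 j)].
have cW : compact W.
  apply: (@rV_compact _ _ (fun j => zonoid mu H (G j))) => j.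
  exact: compact_zonoid.
rewrite (_ : Theta = (W `*` W) `&` \bigcap_i [set M : moments |
  \sum_j ((M.1 ord0 j) ord0 (lshift 1 i) - (M.2 ord0 j) ord0 (lshift 1 i))
    = c ord0 i]); last first.
  by apply/seteqP; split => M /= [h1 h2]; split => // i; [move=> _|]; exact: h2.
apply: compact_closedI; first exact: compact_setX.
apply: closed_bigI => i _.
apply: (preimage_closed _ (@closed_eq R (c ord0 i))) => M _.
apply: continuous_big M => [|j _ M]; first exact: add_continuous.
by apply: continuousB; [exact: coord1_continuous|exact: coord2_continuous].
Qed.

Let cost_continuous : continuous cost.
Proof.
apply: continuous_big => [|j _ M]; first exact: add_continuous.
by apply: continuousD; [exact: coord1_continuous|exact: coord2_continuous].
Qed.

Let bounded_of (f : X -> R) : measurable_fun setT f ->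
  (forall x, `|f x| <= 1) -> bounded_measurable f.
Proof. by move=> mf f1; split => //; exists 1. Qed.

Let intg f : bounded_measurable f -> mu.-integrable H (EFin \o f).
Proof. by move=> bf; exact: bounded_measurable_integrable. Qed.

Let Theta_of_steering u : steering u ->
  exists2 M, Theta M & cost M = \sum_j \int[mu]_(x in H) `|u j x|.
Proof.
move=> [meas_u u1 uc].
pose p j x := Num.max (u j x) 0; pose q j x := Num.max (- u j x) 0.
have mp j : measurable_fun setT (p j) by exact: measurable_maxr.
have mq j : measurable_fun setT (q j).
  by apply: measurable_maxr => //; exact: measurable_funN.
have p01 j x : 0 <= p j x <= 1.
  have := u1 j x; rewrite ler_norml => /andP[h1 h2].
  by rewrite /p le_max lexx orbT ge_max ler01 h2.
have q01 j x : 0 <= q j x <= 1.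
  have := u1 j x; rewrite ler_norml => /andP[h1 h2].
  by rewrite /q le_max lexx orbT ge_max ler01 andbT lerNl.
have bp j : bounded_measurable (p j).
  by apply: bounded_of => // x; have /andP[h ?] := p01 j x; rewrite ger0_norm.
have bq j : bounded_measurable (q j).
  by apply: bounded_of => // x; have /andP[h ?] := q01 j x; rewrite ger0_norm.
have pq j x : p j x - q j x = u j x.
  rewrite /p /q; case: (lerP (u j x) 0) => h;
    by case: (lerP (- u j x) 0) => h'; lra.
have pDq j x : p j x + q j x = `|u j x|.
  rewrite /p /q; case: (lerP (u j x) 0) => h; case: (lerP (- u j x) 0) => h'.
  - by rewrite (_ : u j x = 0) ?normr0 ?addr0//; lra.
  - by rewrite ler0_norm// add0r.
  - by rewrite gtr0_norm// addr0.
  - by lra.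
exists (\row_j vec_integral mu H (fun x => p j x *: G j x),
        \row_j vec_integral mu H (fun x => q j x *: G j x)).
  split => [|i].
    by split => j; rewrite mxE; exact: density_zonoid.
  rewrite -uc summxE; apply: eq_bigr => j _; rewrite !mxE/=.
  under eq_Rintegral do rewrite mxE row_mxEl.
  under [X in _ - X]eq_Rintegral do rewrite mxE row_mxEl.
  rewrite -RintegralB//; try by apply: intg;
    apply: bounded_measurableM => //; exact: bK.
  by apply: eq_Rintegral => x _; rewrite mxE -mulrBl pq.
apply: eq_bigr => j _; rewrite /= !mxE.
under eq_Rintegral do rewrite mxE row_mxEr mxE mulr1.
under [X in _ + X]eq_Rintegral do rewrite mxE row_mxEr mxE mulr1.
rewrite -RintegralD//; try exact: intg.
by apply: eq_Rintegral => x _; rewrite pDq.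
Qed.

(** The sets [E j] and [F j], where the component [j] is to be 1 and -1, may overlap;
on the overlap the component vanishes, which can only decrease the cost. *)
Let steering_of_Theta M : Theta M -> exists u, [/\ steering u,
  forall j x, u j x \in [:: -1; 0; 1]
  & \sum_j \int[mu]_(x in H) `|u j x| <= cost M].
Proof.
move=> [[MZ1 MZ2] Mc].
have /choice[E EP] : forall j, exists E,
    [/\ measurable E, E `<=` H & M.1 ord0 j = vec_integral mu E (G j)].
  by move=> j; exact: (lyapunov mtau mu_tau ab).
have /choice[F FP] : forall j, exists E,
    [/\ measurable E, E `<=` H & M.2 ord0 j = vec_integral mu E (G j)].
  by move=> j; exact: (lyapunov mtau mu_tau ab).
have bE j : bounded_measurable (\1_(E j) : X -> R).
  have [mE _ _] := EP j; apply: bounded_of; first exact: measurable_indic.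
  by move=> x; rewrite indicE; case: (_ \in _); rewrite ?normr1 ?normr0.
have bF j : bounded_measurable (\1_(F j) : X -> R).
  have [mF _ _] := FP j; apply: bounded_of; first exact: measurable_indic.
  by move=> x; rewrite indicE; case: (_ \in _); rewrite ?normr1 ?normr0.
have intI A f : measurable A -> A `<=` H ->
    \int[mu]_(x in A) f x = \int[mu]_(x in H) (\1_A x * f x).
  move=> mA AH; rewrite -{1}(setIidr AH) Rintegral_mkcondr.
  apply: eq_Rintegral => x _; rewrite patchE indicE.
  by case: (x \in A); rewrite ?mul1r ?mul0r.
exists (fun j x => \1_(E j) x - \1_(F j) x); split.
- split=> [j|j x|].
  + by apply: measurable_funB; [have [] := bE j|have [] := bF j].
  + rewrite !indicE; case: (_ \in _); case: (_ \in _);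
      by rewrite ?subrr ?subr0 ?sub0r ?normrN ?normr1 ?normr0.
  + apply/rowP => i; rewrite -Mc summxE; apply: eq_bigr => j _; rewrite !mxE.
    have [mE EH ->] := EP j; have [mF FH ->] := FP j; rewrite !mxE.
    under [X in _ = X - _]eq_Rintegral do rewrite row_mxEl.
    under [X in _ = _ - X]eq_Rintegral do rewrite row_mxEl.
    rewrite (intI _ _ mE EH) (intI _ _ mF FH) -RintegralB//; try by apply: intg;
      apply: bounded_measurableM => //; exact: bK.
    by apply: eq_Rintegral => x _; rewrite mxE mulrBl.
- move=> j x; rewrite !indicE; case: (_ \in _); case: (_ \in _);
    by rewrite ?subrr ?subr0 ?sub0r !inE eqxx ?orbT.
- apply: ler_sum => j _.
  have [mE EH ->] := EP j; have [mF FH ->] := FP j; rewrite !mxE.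
  under [X in _ <= X + _]eq_Rintegral do rewrite row_mxEr mxE.
  under [X in _ <= _ + X]eq_Rintegral do rewrite row_mxEr mxE.
  rewrite (intI _ _ mE EH) (intI _ _ mF FH).
  under [X in _ <= X + _]eq_Rintegral do rewrite mulr1.
  under [X in _ <= _ + X]eq_Rintegral do rewrite mulr1.
  rewrite -RintegralD//; try exact: intg.
  apply: le_Rintegral => //.
  + apply: intg; apply: bounded_of.
      apply: measurableT_comp => //.
      by apply: measurable_funB; [have [] := bE j|have [] := bF j].
    move=> x; rewrite normr_id !indicE; case: (_ \in _); case: (_ \in _);
      by rewrite ?subrr ?subr0 ?sub0r ?normrN ?normr1 ?normr0.
  + by apply: intg; exact: bounded_measurableD.
  + move=> x _; rewrite (le_trans (ler_normB _ _))//.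
    by rewrite !ger0_norm// indicE.
Qed.

Theorem ternary_minimizer : steering !=set0 ->
  exists u, [/\ steering u, forall j x, u j x \in [:: -1; 0; 1]
    & forall v, steering v -> \sum_j \int[mu]_(x in H) `|u j x|
        <= \sum_j \int[mu]_(x in H) `|v j x|].
Proof.
move=> [v0 /Theta_of_steering[M0 M0T _]].
have [M /set_mem MT Mmin] : exists2 M, M \in Theta &
    forall N, N \in Theta -> cost M <= cost N.
  apply: compact_EVT_min; [by exists M0|exact: compact_Theta|].
  exact: continuous_subspaceT.
have [u [su tu uM]] := steering_of_Theta MT.
exists u; split => // v /Theta_of_steering[N NT <-].
by rewrite (le_trans uM)// Mmin// inE.
Qed.

End Ternary.

(** * The matrix exponential and the Lebesgue measure *)

Lemma cvg_mx (T : topologicalType) m n (I : Type) (F : set_system I)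
    (FF : Filter F) (f : I -> 'M[T]_(m, n)) (L : 'M[T]_(m, n)) :
  (forall i j, f x i j @[x --> F] --> L i j) -> f @ F --> L.
Proof.
move=> fL A [P LP PA]; rewrite /= /nbhs/=.
suff : \forall x \near F, forall i j, P i j (f x i j).
  by apply: filterS => x; exact: PA.
apply: filter_forall => i; apply: filter_forall => j.
exact: (fL i j _ (LP i j)).
Qed.

Section MatrixExponential.
Context (R : realType) (n : nat).
Implicit Types M : 'M[R]_n.

Let term M k : 'M[R]_n := k`!%:R^-1 *: M ^+ k.

Lemma expr_mx_entry_bound M (al : R) k i j : (forall i j, `|M i j| <= al) ->
  `|(M ^+ k) i j| <= (n%:R * al) ^+ k.
Proof.
move=> Mal; elim: k i j => [|k IH] i j.
  by rewrite !expr0 mxE; case: (i == j); rewrite ?normr1 ?normr0.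
rewrite !exprS mxE (le_trans (ler_norm_sum _ _ _))//.
have -> : n%:R * al * (n%:R * al) ^+ k = \sum_(l < n) (al * (n%:R * al) ^+ k).
  by rewrite sumr_const card_ord -mulrA mulr_natl.
by apply: ler_sum => l _; rewrite normrM ler_pM.
Qed.

Let term_bound M (al : R) k i j : (forall i j, `|M i j| <= al) ->
  `|term M k i j| <= exp_coeff (n%:R * al) k.
Proof.
move=> Mal; rewrite mxE normrM ger0_norm ?invr_ge0// mulrC.
by rewrite ler_wpM2r ?invr_ge0// expr_mx_entry_bound.
Qed.

Let series_term M N i j :
  series (term M) N i j = series (fun k => term M k i j) N.
Proof. by rewrite /series/= summxE. Qed.

(** If the entries of [M] are bounded by [al], those of [M ^+ k] are bounded by
[(n al) ^ k], and the series of the entries is dominated by that of the scalar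
exponential. *)
Lemma expmx_entry_cvg M i j :
  series (fun k => (k`!%:R^-1 *: M ^+ k) i j) @ \oo --> expmx M i j.
Proof.
pose al := \sum_i \sum_j `|M i j|.
have Mal i' j' : `|M i' j'| <= al.
  rewrite /al (bigD1 i')//= (bigD1 j')//= -addrA lerDl addr_ge0//.
    by apply: sumr_ge0.
  by apply: sumr_ge0 => *; exact: sumr_ge0.
have ce i' j' : cvgn (series (fun k => term M k i' j')).
  apply: normed_cvg; apply: series_le_cvg (is_cvg_series_exp_coeff (n%:R * al)).
  - by move=> k; rewrite normr_ge0.
  - by move=> k; exact: le_trans (term_bound k i' j' Mal).
  - by move=> k; exact: term_bound.
pose L := \matrix_(i, j) limn (series (fun k => term M k i j)).
have cL : series (term M) @ \oo --> L.
  apply: cvg_mx => i' j'; rewrite mxE.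
  under eq_cvg do rewrite series_term.
  exact: ce.
rewrite -[expmx M]/(limn (series (term M))) (cvg_lim _ cL)//.
  by rewrite mxE; exact: ce.
Qed.

Lemma expmx_entry_bound M (al : R) i j : (forall i j, `|M i j| <= al) ->
  `|expmx M i j| <= expR (n%:R * al).
Proof.
move=> Mal; have cL : series (fun k => term M k i j) @ \oo --> expmx M i j.
  exact: expmx_entry_cvg.
apply: (cvgr_to_le (cvg_norm cL)); near=> N.
have al0 : 0 <= al by exact: le_trans (Mal i j).
apply: le_trans (ler_norm_sum _ _ _) _.
apply: (@le_trans _ _ (series (exp_coeff (n%:R * al)) N)).
  by apply: ler_sum => k _; exact: term_bound.
apply: nondecreasing_cvgn_le; last exact: is_cvg_series_exp_coeff.
apply: nondecreasing_series => k _ _; apply: exp_coeff_ge0.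
by rewrite mulr_ge0.
Unshelve. all: by end_near. Qed.

Lemma measurable_expmx_entry d (X : measurableType d) (D : set X)
    (M : X -> 'M[R]_n) i j :
  (forall i j, measurable_fun D (fun x => M x i j)) ->
  measurable_fun D (fun x => expmx (M x) i j).
Proof.
move=> mM.
apply: (@measurable_fun_cvg _ _ _ D
  (fun N x => series (fun k => (k`!%:R^-1 *: M x ^+ k) i j) N)).
  move=> N; apply: measurable_sum => k.
  under eq_fun do rewrite mxE.
  apply: measurable_funM; first exact: measurable_cst.
  elim: k i j => [|k IH] i j.
    by under eq_fun do rewrite expr0; exact: measurable_cst.
  under eq_fun do rewrite exprS mxE.
  by apply: measurable_sum => l; apply: measurable_funM; [exact: mM|exact: IH].
by move=> x _; exact: expmx_entry_cvg.
Qed.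

End MatrixExponential.

Section Lebesgue.
Context (R : realType).

Lemma measurable_lebesgueR_id :
  measurable_fun setT (id : lebesgueR R -> measurableTypeR R).
Proof.
move=> _ A mA; rewrite setTI; exact: sub_caratheodory.
Qed.

Lemma lebesgue_itv_oc (s t : R) : s <= t ->
  (lebesgue R [set x : R | s < x <= t]%R = (t - s)%:E)%E.
Proof.
move=> st.
have -> : [set x : lebesgueR R | s < x <= t] = `]s, t]%classic.
  by apply/seteqP; split => x /=; rewrite in_itv.
have := lebesgue_measure_itv `]s, t]; rewrite /= lte_fin.
move: st; rewrite le_eqVlt => /predU1P[->|st]; first by rewrite ltxx subrr.
by rewrite st -EFinB => <-.
Qed.

End Lebesgue.

(** * Comparison of the costs *)

Section Tight.
Local Open Scope ereal_scope.

(** The minimum of [f], attained at a point [u0] where the two costs agree, is also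
the minimum of [g]; a minimizer of [g] must then have equality in both [f <= g]
and [f u0 <= f]. *)
Lemma optimal_tight (R : realType) (X : Type) (U : set X) (f g : X -> \bar R)
    (P : set X) u0 :
  (forall u, U u -> f u <= g u) -> (forall u, U u -> f u = g u <-> P u) ->
  U u0 -> P u0 -> (forall u, U u -> f u0 <= f u) ->
  optimal U g = [set u | [/\ U u, P u & f u <= f u0]].
Proof.
move=> fg fgP U0 P0 f0; have fg0 : f u0 = g u0 by apply/fgP.
apply/seteqP; split => u /= [].
  move=> Uu gu; have gu0 : g u <= f u0 by rewrite fg0; exact: gu.
  split => //; last exact: le_trans (fg u Uu) gu0.
  apply/fgP => //; apply/le_anti; rewrite fg//=.
  exact: le_trans gu0 (f0 u Uu).
move=> Uu Pu fu; split => // v Uv.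
have /(fgP u Uu) <- := Pu.
exact: le_trans fu (le_trans (f0 v Uv) (fg v Uv)).
Qed.

Lemma ae_le_integral_eq d (X : measurableType d) (R : realType)
    (mu : {measure set X -> \bar R}) (D : set X) (f g : X -> R) :
  measurable D ->
  mu.-integrable D (EFin \o f) -> mu.-integrable D (EFin \o g) ->
  {ae mu, forall x, D x -> (f x <= g x)%R} ->
  \int[mu]_(x in D) (f x)%:E <= \int[mu]_(x in D) (g x)%:E /\
  (\int[mu]_(x in D) (f x)%:E = \int[mu]_(x in D) (g x)%:E <->
   {ae mu, forall x, D x -> f x = g x}).
Proof.
move=> mD fi gi fg.
have iB : \int[mu]_(x in D) (g x - f x)%:E =
    \int[mu]_(x in D) (g x)%:E - \int[mu]_(x in D) (f x)%:E.
  by rewrite integralB_EFin.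
have mB : measurable_fun D (fun x => (g x - f x)%:E).
  apply/measurable_EFinP; apply: measurable_funB; apply/measurable_EFinP.
    exact: (measurable_int mu).
  exact: (measurable_int mu).
have iA : \int[mu]_(x in D) `|(g x - f x)%:E| =
    \int[mu]_(x in D) (g x - f x)%:E.
  apply: ae_eq_integral => //; first exact: measurableT_comp.
  by apply: filterS fg => x h Dx; rewrite /= ger0_norm// subr_ge0 h.
have ff := integrable_fin_num mD fi.
have gf := integrable_fin_num mD gi.
have B0 : 0 <= \int[mu]_(x in D) (g x - f x)%:E by rewrite -iA integral_ge0.
split; first by move: B0; rewrite iB sube_ge0 ?gf ?ff ?orbT.
have [h1 h2] := ae_eq_integral_abs mu mD mB.
split => [E|E].
  have /h1 : \int[mu]_(x in D) `|(g x - f x)%:E| = 0 by rewrite iA iB E subee.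
  apply: filterS => x h /h [] /eqP; rewrite subr_eq0 => /eqP ->//.
apply: ae_eq_integral => //.
- exact: (measurable_int mu).
- exact: (measurable_int mu).
- by apply: filterS E => x h /h ->.
Qed.

End Tight.

(** Away from 0 the right-hand side is 1, which [`|a|] reaches only at [-1] and
[1]. *)
Lemma ternary_leif (R : realDomainType) (a : R) : `|a| <= 1 ->
  `|a| <= (a != 0)%:R ?= iff (a \in [:: -1; 0; 1]).
Proof.
move=> a1; split; first by case: eqP => [->|//]; rewrite normr0.
rewrite !inE; have [->|a0] := eqVneq a 0; first by rewrite normr0 eqxx orbT.
by rewrite eqr_norml ler01 andbT orbC ?orbF /=.
Qed.

Section Controls.
Context d (X : measurableType d) (R : realType).
Context (mu : {measure set X -> \bar R}) (tau : X -> R).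
Hypothesis mtau : measurable_fun setT tau.
Hypothesis mu_tau : forall s t, s <= t ->
  (mu [set x | s < tau x <= t]%R <= (t - s)%:E)%E.
Context (a b : R) (H : set X).
Hypotheses (ab : a <= b) (mH : measurable H).
Hypothesis Hab : H `<=` [set x | a < tau x <= b].
Context (n m : nat) (K : 'I_m -> X -> 'rV[R]_n) (c : 'rV[R]_n).
Hypothesis bK : forall j, bounded_measurable_rV (K j).

Definition admissible : set (X -> 'cV[R]_m) :=
  [set u : X -> 'cV[R]_m | [/\ forall j, measurable_fun H (fun t => u t j ord0),
    forall i, (\int[mu]_(t in H) (\sum_j u t j ord0 * K j t ord0 i)%:E
      = (c ord0 i)%:E)%E
  & {ae mu, forall t, H t -> forall j, `|u t j ord0| <= 1}]].

Definition l1_cost (u : X -> 'cV[R]_m) : \bar R :=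
  (\sum_(j < m) \int[mu]_(t in H) `|u t j ord0|%:E)%E.

Definition l0_cost (u : X -> 'cV[R]_m) : \bar R :=
  (\sum_(j < m) mu (H `&` [set t | u t j ord0 != 0%R]))%E.

Definition ternary_ae (u : X -> 'cV[R]_m) :=
  {ae mu, forall t, H t -> forall j, u t j ord0 \in [:: -1; 0; 1]}.

Let Hfin : (mu H < +oo)%E.
Proof. exact: (clock_finite mtau mu_tau ab mH Hab). Qed.

Let intg (f : X -> R) :
  bounded_measurable f -> mu.-integrable H (EFin \o f).
Proof. by move=> ?; exact: bounded_measurable_integrable. Qed.

Lemma l1_cost_sum (u : X -> 'cV[R]_m) :
  (forall j, measurable_fun H (fun t => u t j ord0)) ->
  l1_cost u = (\int[mu]_(t in H) (\sum_j `|u t j ord0|)%:E)%E.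
Proof.
move=> meas_u; under eq_integral do rewrite -sumEFin.
rewrite ge0_integral_sum//.
by move=> j; apply/measurable_EFinP; exact: measurableT_comp.
Qed.

Let measurable_nonzero (u : X -> 'cV[R]_m) j :
  measurable_fun H (fun t => u t j ord0) ->
  measurable (H `&` [set t | u t j ord0 != 0]).
Proof.
move=> meas_u; have := meas_u mH (~` [set 0]) (measurableC (measurable_set1 _)).
by congr measurable; apply/seteqP; split => t /= [Ht /eqP].
Qed.

Let nonzero_indic (u : X -> 'cV[R]_m) j t : H t ->
  (u t j ord0 != 0)%:R = (\1_(H `&` [set t | u t j ord0 != 0]) t : R).
Proof.
move=> Ht; rewrite indicE; congr ((nat_of_bool _)%:R).
by apply/idP/idP => [h|/set_mem[]//]; apply/mem_set; split.
Qed.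

Let measurable_nonzero_indicator (u : X -> 'cV[R]_m) j :
  measurable_fun H (fun t => u t j ord0) ->
  measurable_fun H (fun t => (u t j ord0 != 0)%:R : R).
Proof.
move=> meas_u.
apply: (eq_measurable_fun
  (\1_(H `&` [set t | u t j ord0 != 0]) : _ -> R)).
  by move=> t /set_mem Ht; rewrite nonzero_indic.
by apply/measurable_funTS/measurable_indic; exact: measurable_nonzero.
Qed.

Lemma l0_cost_sum (u : X -> 'cV[R]_m) :
  (forall j, measurable_fun H (fun t => u t j ord0)) ->
  l0_cost u = (\int[mu]_(t in H) (\sum_j (u t j ord0 != 0)%:R)%:E)%E.
Proof.
move=> meas_u.
under eq_integral do rewrite -sumEFin.
rewrite ge0_integral_sum//; last first.
  by move=> j; apply/measurable_EFinP; exact: measurable_nonzero_indicator.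
apply: eq_bigr => j _.
under eq_integral => t tH do rewrite (nonzero_indic u j (set_mem tH)).
by rewrite integral_indic//; [rewrite setIAC setIid|exact: measurable_nonzero].
Qed.

Let admissible_bound u : admissible u ->
  {ae mu, forall t, H t -> forall j, `|u t j ord0| <= 1}.
Proof. by case. Qed.

(** Control equal to [u] almost everywhere, but bounded everywhere. *)
Let clip (u : X -> 'cV[R]_m) j : X -> R :=
  (fun t => Num.max (-1) (Num.min 1 (u t j ord0))) \_ H.

Let clip_ae u : admissible u ->
  {ae mu, forall t, H t -> forall j, clip u j t = u t j ord0}.
Proof.
move=> [_ _]; apply: filterS => t h Ht j; have := h Ht j.
rewrite /clip patchE mem_set// ler_norml => /andP[h1 h2].
by rewrite min_r// max_r.
Qed.

Let steer_integral v i : (forall j, bounded_measurable (v j)) ->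
  (\int[mu]_(t in H) (\sum_j v j t * K j t ord0 i)%:E =
   ((\sum_j vec_integral mu H (fun x => v j x *: K j x)) ord0 i)%:E)%E.
Proof.
move=> bv; under eq_integral do rewrite -sumEFin.
have bvK j : bounded_measurable (fun t => v j t * K j t ord0 i).
  by apply: bounded_measurableM => //; exact: bK.
rewrite integral_sum; [|exact: mH|by move=> j; exact: intg].
rewrite summxE -sumEFin; apply: eq_bigr => j _; rewrite mxE.
under eq_Rintegral do rewrite mxE.
by rewrite fineK//; exact: (integrable_fin_num mH (intg (bvK j))).
Qed.

Lemma admissible_steering u : admissible u -> steering mu H K c (clip u).
Proof.
move=> fu; have [meas_u cu _] := fu.
have mclip j : measurable_fun setT (clip u j).
  apply/(measurable_restrictT _ mH).
  by apply: measurable_maxr => //; apply: measurable_minr.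
have b1 j t : `|clip u j t| <= 1.
  rewrite /clip patchE; case: ifP => _; last by rewrite normr0.
  rewrite ler_norml le_max lexx/= ge_max ge_min lexx/= andbT.
  by rewrite (le_trans (lerN10 _))// ler01.
have bclip j : bounded_measurable (clip u j) by split => //; exists 1.
split => //; apply/rowP => i.
have /(congr1 fine) /= := steer_integral i bclip => <-.
rewrite -[RHS]/(fine (c ord0 i)%:E) -(cu i); congr fine.
apply: ae_eq_integral => //.
- apply/measurable_EFinP/measurable_funTS/measurable_sum => j.
  by apply: measurable_funM => //; have [] := bK j i.
- apply/measurable_EFinP/measurable_sum => j; apply: measurable_funM => //.
  by apply: measurable_funTS; have [] := bK j i.
- apply: filterS (clip_ae fu) => t h Ht.
  by congr EFin; apply: eq_bigr => j _; rewrite h.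
Qed.

Lemma steering_admissible v : steering mu H K c v ->
  admissible (fun t => \col_j v j t).
Proof.
move=> [mv v1 vc]; split.
- move=> j; under eq_fun do rewrite mxE; exact: measurable_funTS.
- move=> i; have bv j : bounded_measurable (v j) by split => //; exists 1.
  have := steer_integral i bv; rewrite vc => <-.
  apply: eq_integral => t _.
  by congr EFin; apply: eq_bigr => j _; rewrite mxE.
- by apply: aeW => t _ j; rewrite mxE.
Qed.

Lemma l1_cost_clip u : admissible u ->
  l1_cost u = (\sum_j \int[mu]_(t in H) `|clip u j t|)%:E.
Proof.
move=> fu; have [meas_u _ _] := fu; have [mc c1 _] := admissible_steering fu.
rewrite -sumEFin; apply: eq_bigr => j _.
have bc : bounded_measurable (fun t => `|clip u j t|).
  by split; [exact: measurableT_comp|exists 1 => t; rewrite normr_id].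
rewrite fineK; last exact: (integrable_fin_num mH (intg bc)).
apply: ae_eq_integral; first exact: mH.
- by apply/measurable_EFinP; exact: measurableT_comp.
- by apply/measurable_EFinP/measurable_funTS; case: bc.
- by apply: filterS (clip_ae fu) => t h Ht; rewrite h.
Qed.

Lemma ternary_l1_minimizer : admissible !=set0 ->
  exists u0, [/\ admissible u0, ternary_ae u0
  & forall u, admissible u -> (l1_cost u0 <= l1_cost u)%E].
Proof.
move=> [u /admissible_steering su].
have [|v [sv tv vmin]] :=
    ternary_minimizer (c := c) mtau mu_tau ab mH Hab bK.
  by exists (clip u).
exists (fun t => \col_j v j t); split; first exact: steering_admissible.
  by apply: aeW => t _ j; rewrite mxE.
move=> w fw; rewrite (l1_cost_clip fw).
have -> : l1_cost (fun t => \col_j v j t) =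
    (\sum_j \int[mu]_(t in H) `|v j t|)%:E.
  have [mv v1 _] := sv; rewrite -sumEFin; apply: eq_bigr => j _.
  have bc : bounded_measurable (fun t => `|v j t|).
    by split; [exact: measurableT_comp|exists 1 => t; rewrite normr_id].
  rewrite fineK; last exact: (integrable_fin_num mH (intg bc)).
  by apply: eq_integral => t _; rewrite mxE.
by rewrite lee_fin; exact/vmin/admissible_steering.
Qed.

Let integrable_l1 u : admissible u ->
  mu.-integrable H (EFin \o (fun t => \sum_j `|u t j ord0|)).
Proof.
move=> fu; have [meas_u _ _] := fu; apply/integrableP; split.
  by apply/measurable_EFinP/measurable_sum => j; exact: measurableT_comp.
rewrite (_ : (\int[mu]_(x in H) _)%E = l1_cost u).
  by rewrite l1_cost_clip// ltry.
rewrite l1_cost_sum//; apply: eq_integral => t _ /=.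
by rewrite ger0_norm// sumr_ge0.
Qed.

Lemma l1_cost_le_l0_cost u : admissible u -> (l1_cost u <= l0_cost u)%E /\
  (l1_cost u = l0_cost u <-> ternary_ae u).
Proof.
move=> fu; have [meas_u _ _] := fu; rewrite l1_cost_sum// l0_cost_sum//.
have lf : {ae mu, forall t, H t -> (\sum_j `|u t j ord0| <=
    \sum_j ((u t j ord0 != 0)%:R : R)
    ?= iff [forall j, u t j ord0 \in [:: -1; 0; 1]])}.
  apply: filterS (admissible_bound fu) => t h Ht.
  by apply: leif_sum => j _; apply: ternary_leif; exact: h.
have [||||le eq] := @ae_le_integral_eq _ _ R mu H
  (fun t => \sum_j `|u t j ord0|) (fun t => \sum_j (u t j ord0 != 0)%:R).
- exact: mH.
- exact: integrable_l1.
- apply: measurable_bounded_integrable.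
  + exact: mH.
  + exact: Hfin.
  + by apply: measurable_sum => j; exact: measurable_nonzero_indicator.
  + exists m%:R; split; first exact: num_real.
    move=> M mM t _ /=; rewrite ger0_norm ?sumr_ge0// (le_trans _ (ltW mM))//.
    rewrite -[m in leRHS]card_ord -sum1_card natr_sum.
    by apply: ler_sum => j _; case: (_ != 0).
- by apply: filterS lf => t h Ht; exact: (h Ht).1.
split => //; apply: (iff_trans eq); split => E.
  apply: filterS2 lf E => t h h' Ht; apply/forallP; rewrite -(h Ht).2.
  by apply/eqP; exact: h'.
apply: filterS2 lf E => t h h' Ht; apply/eqP; rewrite (h Ht).2.
by apply/forallP; exact: h'.
Qed.

Context (phi : 'cV[R]_m -> R) (phi_ : 'I_m -> R -> R) (g : R).
Hypothesis phiE : forall v : 'cV[R]_m, phi v = \sum_(j < m) phi_ j (v j ord0).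
Hypothesis phi_even : forall j (a : R), 0 <= a <= 1 -> phi_ j a = phi_ j (- a).
Hypothesis phi_0 : forall j, phi_ j 0 = 0.
Hypothesis phi_lt : forall j (a : R), -1 < a < 1 -> a != 0 ->
  phi_ j a < phi_ j 1 * `|a|.
Hypothesis phi_1 : forall j, phi_ j 1 = g.
Hypothesis g_lt1 : g < 1.
Hypothesis phi_int : forall u, admissible u ->
  mu.-integrable H (fun t => (phi (u t))%:E).

Definition j_cost (u : X -> 'cV[R]_m) : \bar R :=
  (l1_cost u - \int[mu]_(t in H) (phi (u t))%:E)%E.

(** At -1, 0 and 1 the two sides agree by evenness and normalization; elsewhere
strict inequality is the hypothesis on [phi_]. *)
Lemma phi_leif j r : `|r| <= 1 ->
  phi_ j r <= g * `|r| ?= iff (r \in [:: -1; 0; 1]).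
Proof.
rewrite ler_norml => /andP[r1 r2].
have [|nt] := boolP (r \in _).
  rewrite !inE => rt; have -> : phi_ j r = g * `|r|.
    case/or3P: rt => /eqP ->.
    - by rewrite -phi_even ?ler01 ?lexx// phi_1 normrN normr1 mulr1.
    - by rewrite phi_0 normr0 mulr0.
    - by rewrite phi_1 normr1 mulr1.
  by split; rewrite ?eqxx.
move: nt; rewrite !inE !negb_or => /and3P[n1 n0 n2].
have lt : phi_ j r < g * `|r|.
  rewrite -(phi_1 j); apply: phi_lt => //.
  by rewrite !lt_neqAle r1 r2 eq_sym n1 n2.
by split; [exact: ltW|rewrite lt_eqF].
Qed.

(** Only the sum [phi (u t)] is known to be integrable, its individual terms might
not even be measurable; so the two costs are compared as integrals of sums over
the components. *)
Lemma l1_cost_le_j_cost u : admissible u ->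
  ((1 - g)%:E * l1_cost u <= j_cost u)%E /\
  ((1 - g)%:E * l1_cost u = j_cost u <-> ternary_ae u)%E.
Proof.
move=> fu; have [meas_u _ _] := fu.
have -> : j_cost u =
    (\int[mu]_(t in H) (\sum_j `|u t j ord0| - phi (u t))%:E)%E.
  rewrite /j_cost l1_cost_sum// integralB_EFin//; first exact: integrable_l1.
  exact: phi_int.
have -> : ((1 - g)%:E * l1_cost u =
    \int[mu]_(t in H) ((1 - g) * \sum_j `|u t j ord0|)%:E)%E.
  rewrite l1_cost_sum//; under [RHS]eq_integral do rewrite EFinM.
  by rewrite integralZl//; exact: integrable_l1.
have lf : {ae mu, forall t, H t -> (phi (u t) <=
    g * \sum_j `|u t j ord0| ?= iff [forall j, u t j ord0 \in [:: -1; 0; 1]])}.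
  apply: filterS (admissible_bound fu) => t h Ht; rewrite phiE mulr_sumr.
  by apply: leif_sum => j _; apply: phi_leif; exact: h.
have [||||le eq] := @ae_le_integral_eq _ _ R mu H
  (fun t => (1 - g) * \sum_j `|u t j ord0|)
  (fun t => \sum_j `|u t j ord0| - phi (u t)).
- exact: mH.
- exact: (integrableZl mH (1 - g) (integrable_l1 fu)).
- exact: (integrableB mH (integrable_l1 fu) (phi_int fu)).
- by apply: filterS lf => t h Ht; have := (h Ht).1; lra.
split => //; apply: (iff_trans eq); split => E.
  apply: filterS2 lf E => t h h' Ht; apply/forallP; rewrite -(h Ht).2.
  by apply/eqP; have := h' Ht; lra.
apply: filterS2 lf E => t h h' Ht.
have /eqP -> : phi (u t) == g * \sum_j `|u t j ord0|.
  by rewrite (h Ht).2; apply/forallP; exact: h'.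
by rewrite mulrBl mul1r.
Qed.

Lemma optimal_l0_j : admissible !=set0 ->
  [/\ optimal admissible l0_cost !=set0, optimal admissible j_cost !=set0
    & optimal admissible l0_cost = optimal admissible j_cost].
Proof.
move=> /ternary_l1_minimizer[u0 [f0 t0 min0]].
have mul1g u v : ((1 - g)%:E * l1_cost u <= (1 - g)%:E * l1_cost v =
    (l1_cost u <= l1_cost v))%E by rewrite lee_pmul2l// lte_fin subr_gt0.
have E0 : optimal admissible l0_cost =
    [set u | [/\ admissible u, ternary_ae u & (l1_cost u <= l1_cost u0)%E]].
  by apply: optimal_tight => // u fu; have [] := l1_cost_le_l0_cost fu.
have EJ : optimal admissible j_cost =
    [set u | [/\ admissible u, ternary_ae u & (l1_cost u <= l1_cost u0)%E]].
  rewrite (@optimal_tight _ _ admissible (fun u => (1 - g)%:E * l1_cost u)%E _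
    ternary_ae u0)//; try by move=> u fu; have [] := l1_cost_le_j_cost fu.
    by apply/seteqP; split => u [fu tu h]; split; rewrite // mul1g in h *.
  by move=> u fu; rewrite mul1g min0.
by rewrite EJ E0; split => //; exists u0.
Qed.

End Controls.

(** * The linear control system *)

Section LinearSystem.
Context (R : realType) (n m : nat) (A : 'M[R]_n) (B : 'M[R]_(n, m))
  (x0 : 'cV[R]_n) (T : R).

Local Notation mu := (lebesgue R).
Local Notation H := (horizon T).

Let measurable_itv_lebesgueR (i : interval R) :
  measurable ([set` i] : set (lebesgueR R)).
Proof.
have := @measurable_lebesgueR_id R measurableT _ (measurable_itv i).
by rewrite setTI.
Qed.

Lemma measurable_horizon : measurable H.
Proof.
rewrite (_ : H = [set` `[0, T]]); first exact: measurable_itv_lebesgueR.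
by apply/seteqP; split => t /=; rewrite in_itv.
Qed.

Lemma horizon_sub : H `<=` [set t : lebesgueR R | (-1 : R) < t <= T].
Proof.
move=> t /andP[t0 tT]; apply/andP; split => //.
exact: lt_le_trans (ltrN10 _) t0.
Qed.

(** Extended by 0 off the horizon, in order to be bounded on the whole line. *)
Definition input_kernel (j : 'I_m) (t : lebesgueR R) : 'rV[R]_n :=
  \row_i ((fun t : lebesgueR R => (expmx (- (t : R) *: A) *m B) i j) \_ H) t.

Lemma bounded_measurable_input_kernel j : bounded_measurable_rV (input_kernel j).
Proof.
move=> i; under eq_fun do rewrite mxE.
have mE l : measurable_fun H
    (fun t : lebesgueR R => expmx (- (t : R) *: A) i l).
  apply: measurable_expmx_entry => i' j'.
  under eq_fun do rewrite mxE.
  apply: measurable_funM; last exact: measurable_cst.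
  by apply: measurable_funN; exact/measurable_funTS/measurable_lebesgueR_id.
split.
  apply/(measurable_restrictT _ measurable_horizon).
  under eq_fun do rewrite mxE.
  apply: measurable_sum => l; apply: measurable_funM; first exact: mE.
  exact: measurable_cst.
pose al := T * \sum_i \sum_j `|A i j|.
have Mal t i' j' : H t -> `|(- (t : R) *: A) i' j'| <= al.
  move=> /andP[t0 tT]; rewrite mxE normrM normrN (ger0_norm t0) /al ler_pM//.
  rewrite (bigD1 i')//= (bigD1 j')//= -addrA lerDl addr_ge0//.
    by apply: sumr_ge0.
  by apply: sumr_ge0 => *; exact: sumr_ge0.
exists (\sum_l expR (n%:R * al) * `|B l j|) => t; rewrite patchE.
have s0 : 0 <= \sum_l expR (n%:R * al) * `|B l j|.
  by apply: sumr_ge0 => l _; rewrite mulr_ge0// expR_ge0.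
case: ifPn => [/set_mem Ht|_]; last by rewrite normr0.
rewrite mxE (le_trans (ler_norm_sum _ _ _))//; apply: ler_sum => l _.
rewrite normrM ler_wpM2r//; apply: expmx_entry_bound => i' j'; exact: Mal.
Qed.

Lemma Linfnorm_le1 (u : control R m) : (Linfnorm T u <= 1)%E <->
  {ae mu, forall t, H t -> forall j, `|u t j ord0| <= 1}.
Proof.
split.
  move=> /bigmax_leP[_ h].
  have : {ae mu, forall t, forall j,
      (((fun t => `|u t j ord0|%:E) \_ H) t <= 1)%E}.
    by apply: filter_forall => j; apply/ess_supP; exact: h.
  apply: filterS => t h' Ht j; have := h' j.
  by rewrite patchE mem_set.
move=> h; apply/bigmax_leP; split => // j _; apply/ess_supP.
apply: filterS h => t h; rewrite patchE; case: ifPn => [/set_mem Ht|_].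
  by rewrite lee_fin; exact: h.
by rewrite lee_fin.
Qed.

Lemma feasible_admissible : feasible A B x0 T =
  admissible mu H input_kernel (\row_i - x0 i ord0) :> set (control R m).
Proof.
have E (u : control R m) i :
    (\int[mu]_(t in H) ((expmx (- (t : R) *: A) *m B *m u t) i ord0)%:E =
     \int[mu]_(t in H) (\sum_j u t j ord0 * input_kernel j t ord0 i)%:E)%E.
  apply: eq_integral => t tH; congr EFin; rewrite mxE.
  by apply: eq_bigr => j _; rewrite [in RHS]mxE patchE tH mulrC.
apply/seteqP; split => u [meas_u cu bu]; split.
- exact: meas_u.
- by move=> i; rewrite -E cu mxE.
- exact/Linfnorm_le1.
- exact: meas_u.
- by move=> i; rewrite E cu mxE.
- exact/Linfnorm_le1.
Qed.

End LinearSystem.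

Theorem theorem2 (R : realType) (n m : nat) (A : 'M[R]_n) (B : 'M[R]_(n, m))
  (x0 : 'cV[R]_n) (T : R) (T_gt0 : 0 < T) (phi : 'cV[R]_m -> R)
  (phiA : exists phi_ : 'I_m -> R -> R,
    [/\ (* A1 *) forall u : 'cV[R]_m, phi u = \sum_(j < m) phi_ j (u j ord0),
        (* A2 *) forall j (a : R), 0 <= a <= 1 -> phi_ j a = phi_ j (- a),
        (* A3 *) forall j,
          [/\ phi_ j 0 = 0,
              forall a : R, -1 < a < 1 -> a != 0 ->
                phi_ j a < phi_ j 1 * `|a|
            & phi_ j 1 < 1]
      & (* A4 *) forall i j, phi_ i 1 = phi_ j 1])
  (J_real : forall u, feasible A B x0 T u ->
    (lebesgue R).-integrable (horizon T) (fun t => (phi (u t))%:E))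
  (U_neq0 : feasible A B x0 T !=set0) :
  [/\ optimal (feasible A B x0 T) (L0norm T) !=set0,
      optimal (feasible A B x0 T) (Jcost T phi) !=set0
    & optimal (feasible A B x0 T) (L0norm T)
      = optimal (feasible A B x0 T) (Jcost T phi)].
Proof.
have [phi_ [phiE phi_even phi3 phi_eq]] := phiA.
have [g g_lt1 phi_1] : exists2 g, g < 1 & forall j, phi_ j 1 = g.
  (* Without any component every [g < 1] will do. *)
  case: (pickP 'I_m) => [j0 _|no_j]; last first.
    by exists 0 => // j; have := no_j j.
  by exists (phi_ j0 1) => [|j]; [have [] := phi3 j0|exact: phi_eq].
have clock (s t : R) : s <= t ->
    (lebesgue R [set x : lebesgueR R | s < (x : R) <= t]%R <= (t - s)%:E)%E.
  by move=> /lebesgue_itv_oc ->.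
(* The clock starts at -1, before 0, because the left end of the time
   interval is excluded. *)
rewrite feasible_admissible in J_real U_neq0 *.
apply: (optimal_l0_j (@measurable_lebesgueR_id R) clock
  (le_trans (lerN10 _) (ltW T_gt0)) (measurable_horizon T) (@horizon_sub R T)
  (bounded_measurable_input_kernel A B T)
  phiE phi_even _ _ phi_1 g_lt1 J_real U_neq0) => j.
  by have [] := phi3 j.
by have [] := phi3 j.
Qed.
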